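(* Let $d\in\mathbb{Z}_{\ge2}$ and let $(\mathbf{R},\le)$ be an ordered field satisfying $[\mathrm{IVT}]_{d^2}$. Let $a,b\in\mathbf{R}$ with $a<b$, $I:=[a,b]$, $n\in\mathbb{Z}_{\ge1}$ and $\sigma,\tau\in\{-1,1\}^{n-1}$. If $(S_0,\dots,S_n)$ is a Sturm $(\sigma,\tau)$-chain with respect to $I$ and $\deg S_0,\dots,\deg S_n\le d^2$, then $$\mathrm{Ind}_a^b(S_1,S_0)+\epsilon(\sigma,\tau)_n\,\mathrm{Ind}_a^b(S_{n-1},S_n)=\mathrm{Var}(\sigma,\tau)_a^b(S_0,\dots,S_n).$$
   Context: For $n\in\mathbb{Z}_{\ge1}$, $[\mathrm{IVT}]_n$ is the property of an ordered field $(\mathbf{R},\le)$: for every $F\in\mathbf{R}[X]$ with $\deg F\le n$ and every $a<b$ in $\mathbf{R}$ with $F(a)F(b)<0$, there is $c\in\mathbf{R}$ with $a<c<b$ and $F(c)=0$. $(\sigma,\tau)$-chains: let $I$ be an interval of $\mathbf{R}$, $n\in\mathbb{Z}_{\ge1}$, $\sigma=(\sigma_1,\dots,\sigma_{n-1}),\tau=(\tau_1,\dots,\tau_{n-1})\in\{-1,1\}^{n-1}$. A sequence $(S_0,\dots,S_n)$ of polynomials in $\mathbf{R}[X]$ is a $(\sigma,\tau)$-chain with respect to $I$ if for $1\le i\le n-1$ there exist $A_i,B_i,C_i\in\mathbf{R}[X]$ such that $A_iS_{i+1}+B_iS_i+C_iS_{i-1}=0$ and, for every $x\in I$, $\mathrm{sign}(A_i(x))=\sigma_i$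 and $\mathrm{sign}(C_i(x))=\tau_i$. (For $n=1$ the condition is empty.) It is a Sturm $(\sigma,\tau)$-chain with respect to $I$ if it is a $(\sigma,\tau)$-chain with respect to $I$ and $S_{n-1}$ and $S_n$ have no common root on $I$. Sign variations: $\mathrm{sign}(x)\in\{-1,0,1\}$ is the sign of $x\in\mathbf{R}$. For $P,Q\in\mathbf{R}[X]$, $\mathrm{Var}_x(P,Q)=\frac12|\mathrm{sign}(P(x))-\mathrm{sign}(Q(x))|$ and $\mathrm{Var}_a^b(P,Q)=\mathrm{Var}_a(P,Q)-\mathrm{Var}_b(P,Q)$. For $1\le i\le n$, $\epsilon(\sigma,\tau)_i:=\prod_{1\le j\le i-1}\sigma_j\tau_j$ (so $\epsilon(\sigma,\tau)_1=1$), and $\mathrm{Var}(\sigma,\tau)_a^b(S_0,\dots,S_n):=\sum_{1\le i\le n}\epsilon(\sigma,\tau)_i\,\mathrm{Var}_a^b(S_{i-1},S_i)$. Cauchy index: for $x\in\mathbf{R}$ and $P,Q\in\mathbf{R}[X]\setminus\{0\}$ write uniquely $P=(X-x)^{\mu(x)}\widetilde P$, $Q=(X-x)^{\nu(x)}\widetilde Q$ with $\mu(x),\nu(x)\in\mathbb{Z}_{\ge0}$, $\widetilde P(x)\ne0$, $\widetilde Q(x)\neq0$. Put $\mathrm{Ind}_x^{+}(Q,P)=\frac12\mathrm{sign}(\widetilde Q(x)\widetilde P(x))$ and $\mathrm{Ind}_x^{-}(Q,P)=\frac12(-1)^{\mu(x)-\nu(x)}\mathrm{sign}(\widetilde Q(x)\widetilde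 P(x))$ if $\mu(x)>\nu(x)$, and both equal to $0$ otherwise; put $\mathrm{Ind}_x(Q,P)=\mathrm{Ind}_x^+(Q,P)-\mathrm{Ind}_x^-(Q,P)$. For $a<b$ and $P,Q\neq0$, $\mathrm{Ind}_a^b(Q,P)=\mathrm{Ind}_a^+(Q,P)+\sum_{x\in(a,b)}\mathrm{Ind}_x(Q,P)-\mathrm{Ind}_b^-(Q,P)$ (only roots of $P$ in $(a,b)$ contribute). If $a<b$ and $P=0$ or $Q=0$, $\mathrm{Ind}_a^b(Q,P)=0$. *)

(* Defs.v *)
From HB Require Import structures.
From mathcomp Require Import all_boot all_order all_algebra.
From mathcomp Require Import classical_sets fsbigop.

Set Implicit Arguments.
Unset Strict Implicit.
Unset Printing Implicit Defensive.

Import Order.TTheory GRing.Theory Num.Theory.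
Local Open Scope ring_scope.
Local Open Scope classical_set_scope.

(* Conventions: an ordered field is a realFieldType (neither archimedean nor
   real closed in general).  Signs are integers; sign variations and Cauchy
   indices, which are half-integers, take their values in rat. *)

Definition IVT (R : realFieldType) (n : nat) : Prop :=
  forall F : {poly R}, (size F <= n.+1)%N ->
  forall a b : R, a < b -> F.[a] * F.[b] < 0 ->
  exists c : R, a < c < b /\ F.[c] = 0.

(* sigma`_i.-1 stands for sigma_i, because the mathematical indices of sigma
   and tau run over 1, ..., n - 1; the indices of Ss run over 0, ..., n. *)
Definition chain (R : realFieldType) (n : nat) (sigma tau : n.-1.-tuple int)
    (I : interval R) (Ss : n.+1.-tuple {poly R}) : Prop :=
  forall i : nat, (1 <= i <= n.-1)%N ->
  exists A B C : {poly R},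
    A * Ss`_i.+1 + B * Ss`_i + C * Ss`_i.-1 = 0 /\
    (forall x : R, x \in I ->
       sgz A.[x] = sigma`_i.-1 /\ sgz C.[x] = tau`_i.-1).

Definition sturm_chain (R : realFieldType) (n : nat)
    (sigma tau : n.-1.-tuple int) (I : interval R)
    (Ss : n.+1.-tuple {poly R}) : Prop :=
  chain sigma tau I Ss /\
  ~ (exists x : R, [/\ x \in I, root Ss`_n.-1 x & root Ss`_n x]).

Definition eps (n : nat) (sigma tau : n.-1.-tuple int) (i : nat) : int :=
  \prod_(1 <= j < i) (sigma`_j.-1 * tau`_j.-1).

Definition var_at (R : realFieldType) (x : R) (P Q : {poly R}) : rat :=
  `|sgz P.[x] - sgz Q.[x]|%:~R / 2.

Definition var_ab (R : realFieldType) (a b : R) (P Q : {poly R}) : rat :=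
  var_at a P Q - var_at b P Q.

Definition var_chain (R : realFieldType) (n : nat)
    (sigma tau : n.-1.-tuple int) (a b : R) (Ss : n.+1.-tuple {poly R}) : rat :=
  \sum_(1 <= i < n.+1) (eps sigma tau i)%:~R * var_ab a b Ss`_i.-1 Ss`_i.

(* For P != 0, P = ('X - x%:P) ^+ mup x P * unit_part x P, and x is not a root
   of unit_part x P. *)
Definition unit_part (R : realFieldType) (x : R) (P : {poly R}) : {poly R} :=
  P %/ ('X - x%:P) ^+ mup x P.

(* The local indices are meaningful only for nonzero P and Q; ind_ab treats the
   zero case separately. *)
Definition ind_right (R : realFieldType) (x : R) (Q P : {poly R}) : rat :=
  if (mup x Q < mup x P)%N
  then (sgz ((unit_part x Q).[x] * (unit_part x P).[x]))%:~R / 2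
  else 0.

Definition ind_left (R : realFieldType) (x : R) (Q P : {poly R}) : rat :=
  if (mup x Q < mup x P)%N
  then (-1) ^+ (mup x P - mup x Q)
       * (sgz ((unit_part x Q).[x] * (unit_part x P).[x]))%:~R / 2
  else 0.

Definition ind_at (R : realFieldType) (x : R) (Q P : {poly R}) : rat :=
  ind_right x Q P - ind_left x Q P.

(* The sum over the open interval has finite support, since ind_at x Q P = 0
   unless x is a root of P.  Only used for a < b. *)
Definition ind_ab (R : realFieldType) (a b : R) (Q P : {poly R}) : rat :=
  if (P == 0) || (Q == 0) then 0
  else ind_right a Q P
       + \sum_(x \in [set x : R | a < x < b]) ind_at x Q P
       - ind_left b Q P.

(* Main.v *)
(** The pair inversion formula Ind(Q,P) + Ind(P,Q) = Var_a^b(P,Q), for P and Q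
    without common root on [a,b], is local: at every point x the one-sided
    indices sum to the variation of the values at x minus the variation of the
    one-sided signs of P and Q near x.  The intermediate value property says
    that the sign of P right of a root of P * Q equals its sign left of the next
    one, so these local contributions telescope over the interval.  At a root
    x in I of S_i the chain relation reads A_i(x) S_(i+1)(x) = - C_i(x) S_(i-1)(x),
    whence Ind(S_(i-1),S_i) = - sigma_i tau_i Ind(S_(i+1),S_i), and the weighted
    sum of the pair formulas telescopes as well. *)

Require Import Defs.
From mathcomp Require Import all_boot all_order all_algebra.
From mathcomp Require Import boolp fsbigop.
From mathcomp Require Import lra.

Import Order.TTheory GRing.Theory Num.Theory.
Local Open Scope ring_scope.

(** * Roots, multiplicities and one-sided signs *)

Lemma sgz_neq0 {R : realFieldType} {x : R} : x != 0 -> sgz x = 1 \/ sgz x = -1.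
Proof. by move=> x0; case: (sgzP x) x0; rewrite ?eqxx; auto. Qed.

Lemma finite_roots {R : realFieldType} {P : {poly R}} : P != 0 ->
  exists r : seq R, forall x, root P x -> x \in r.
Proof.
have [n] := ubnP (size P); elim: n P => // n IHn P szP P0.
(* Whether a root exists is decided classically; each root found splits off a linear factor and
   lowers the size. *)
have [[x Px]|noroot] := pselect (exists x, root P x); last first.
  by exists [::] => x Px; case: noroot; exists x.
have [Q PE] := factor_theorem P x Px.
have Q0 : Q != 0 by apply: contraNneq P0 => Q0; rewrite PE Q0 mul0r.
have [|//|r rP] := IHn Q.
  by move: szP; rewrite PE size_Mmonic ?monicXsubC// size_XsubC addn2.
exists (x :: r) => y; rewrite PE rootM root_XsubC inE orbC.
by case/orP => [->//|/rP ->]; rewrite orbT.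
Qed.

Lemma finite_roots_itv {R : realFieldType} {P : {poly R}} (a b : R) : P != 0 ->
  exists r : seq R, [/\ sorted <%R r, forall x, x \in r -> a < x < b
    & forall x, a < x < b -> root P x -> x \in r].
Proof.
move=> /finite_roots[r rP].
exists (sort <=%R [seq x <- undup r | a < x < b]); split.
- by rewrite sort_lt_sorted filter_uniq ?undup_uniq.
- by move=> x; rewrite mem_sort mem_filter => /andP[].
- by move=> x xab /rP xr; rewrite mem_sort mem_filter xab mem_undup.
Qed.

Lemma unit_partK {R : realFieldType} (x : R) (P : {poly R}) : P != 0 ->
  unit_part x P * ('X - x%:P) ^+ mup x P = P.
Proof. by move=> P0; rewrite /unit_part divpK// -mup_geq. Qed.

(** A root of the unit part at [x] would let one more power of ['X - x%:P] divide [P] than its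
    multiplicity allows. *)
Lemma unit_part_nroot {R : realFieldType} (x : R) (P : {poly R}) : P != 0 ->
  (unit_part x P).[x] != 0.
Proof.
move=> P0; apply/negP => /(factor_theorem _ _) [Q QE].
suff : (mup x P < mup x P)%N by rewrite ltnn.
rewrite mup_geq// -[X in _ %| X](unit_partK x P P0) QE -mulrA -exprS.
exact: dvdp_mulIr.
Qed.

Lemma mup_uniq {R : realFieldType} (x : R) (U : {poly R}) (m : nat) :
  U.[x] != 0 -> mup x (U * ('X - x%:P) ^+ m) = m.
Proof. by move=> Ux; rewrite mupMr// mup_XsubCX eqxx. Qed.

Lemma unit_part_uniq {R : realFieldType} (x : R) (U : {poly R}) (m : nat) :
  U.[x] != 0 -> unit_part x (U * ('X - x%:P) ^+ m) = U.
Proof.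
by move=> Ux; rewrite /unit_part mup_uniq// mulpK// expf_neq0// polyXsubC_eq0.
Qed.

Lemma unit_part_id {R : realFieldType} (x : R) (P : {poly R}) :
  P.[x] != 0 -> unit_part x P = P.
Proof.
by move=> Px; rewrite -[P in LHS]mulr1 -(expr0 ('X - x%:P)) unit_part_uniq.
Qed.

(* The signs of P immediately to the right and to the left of x. *)
Definition sign_right {R : realFieldType} (x : R) (P : {poly R}) : int :=
  sgz (unit_part x P).[x].

Definition sign_left {R : realFieldType} (x : R) (P : {poly R}) : int :=
  (-1) ^+ mup x P * sign_right x P.

(** Dividing out all powers of ['X - x%:P] and ['X - y%:P] leaves a divisor [V] of [P] that vanishes
    nowhere on [x, y] and obeys the same size bound, so [IVT] gives [V] equal signs at [x] and [y].
    Of the removed factors, (y - x)^m is positive and (x - y)^k has the sign (-1)^k that enters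
    [sign_left]. *)
Lemma sign_right_left {R : realFieldType} {n : nat} (hR : IVT R n)
    {P : {poly R}} {x y : R} :
  (size P <= n.+1)%N -> P != 0 -> x < y ->
  (forall z, x < z < y -> ~~ root P z) -> sign_right x P = sign_left y P.
Proof.
move=> szP P0 xy noroot.
pose U := unit_part x P; pose m := mup x P.
have PE : U * ('X - x%:P) ^+ m = P by exact: unit_partK.
have Ux : U.[x] != 0 by exact: unit_part_nroot.
have U0 : U != 0 by apply: contraNneq P0 => U0; rewrite -PE U0 mul0r.
pose V := unit_part y U; pose k := mup y U.
have UE : V * ('X - y%:P) ^+ k = U by exact: unit_partK.
have Vy : V.[y] != 0 by exact: unit_part_nroot.
have V0 : V != 0 by apply: contraNneq U0 => V0; rewrite -UE V0 mul0r.
have Vx : V.[x] != 0.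
  by apply: contraNneq Ux => V0x; rewrite -UE hornerM V0x mul0r.
have VP : V %| P by rewrite -PE -UE -mulrA dvdp_mulIl.
have Vxy : 0 < V.[x] * V.[y].
  rewrite lt_neqAle eq_sym mulf_neq0//= leNgt; apply/negP => neg.
  have [|c [cxy Vc]] := hR V _ x y xy neg.
    exact: leq_trans (dvdp_leq P0 VP) szP.
  have := noroot c cxy; rewrite -PE -UE !rootM.
  by rewrite (_ : root V c)//; apply/eqP.
have PE' : (V * ('X - x%:P) ^+ m) * ('X - y%:P) ^+ k = P.
  by rewrite -PE -UE mulrAC.
have yx : 0 < y - x by rewrite subr_gt0.
have Wy : (V * ('X - x%:P) ^+ m).[y] != 0.
  by rewrite hornerM horner_exp hornerXsubC mulf_neq0// expf_neq0// gt_eqF.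
have -> : sign_left y P = (-1) ^+ k * sgz V.[y].
  rewrite /sign_left /sign_right -PE' mup_uniq// unit_part_uniq//.
  rewrite hornerM horner_exp hornerXsubC sgzM (gtr0_sgz (exprn_gt0 _ yx)).
  by rewrite mulr1.
rewrite /sign_right -/U -UE hornerM horner_exp hornerXsubC sgzM sgzX.
rewrite (@ltr0_sgz _ (x - y)) ?subr_lt0// mulrC; congr (_ * _).
have := gtr0_sgz Vxy; rewrite sgzM.
by case: (sgz_neq0 Vx) => ->; case: (sgz_neq0 Vy) => ->.
Qed.

Lemma sign_right_neq0 {R : realFieldType} (x : R) (P : {poly R}) : P != 0 ->
  sign_right x P = 1 \/ sign_right x P = -1.
Proof. by move=> P0; apply/sgz_neq0/unit_part_nroot. Qed.

Lemma sign_left_neq0 {R : realFieldType} (x : R) (P : {poly R}) : P != 0 ->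
  sign_left x P = 1 \/ sign_left x P = -1.
Proof.
move=> P0; rewrite /sign_left -signr_odd.
by case: (sign_right_neq0 x P P0) => ->; case: odd; auto.
Qed.

Lemma sign_right_nroot {R : realFieldType} (x : R) (P : {poly R}) :
  P.[x] != 0 -> sign_right x P = sgz P.[x].
Proof. by move=> Px; rewrite /sign_right unit_part_id. Qed.

Lemma sign_left_nroot {R : realFieldType} (x : R) (P : {poly R}) :
  P.[x] != 0 -> sign_left x P = sgz P.[x].
Proof. by move=> Px; rewrite /sign_left sign_right_nroot// mupNroot// mul1r. Qed.

(** * The inversion formula at a point *)

Definition sgn_var (s t : int) : rat := `|s - t|%:~R / 2.

(** Common form of both one-sided indices, with [s] the right or the left sign at [x], so that each
    local argument is made once. *)
Definition half_ind {R : realFieldType} (x : R) (s : {poly R} -> int)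
    (Q P : {poly R}) : rat :=
  if (mup x Q < mup x P)%N then (s Q * s P)%:~R / 2 else 0.

Lemma ind_rightE {R : realFieldType} (x : R) (Q P : {poly R}) :
  ind_right x Q P = half_ind x (sign_right x) Q P.
Proof. by rewrite /ind_right sgzM. Qed.

(** The difference and the sum of the two multiplicities have the same parity, so the sign power
    distributes over the left signs of [Q] and [P]. *)
Lemma ind_leftE {R : realFieldType} (x : R) (Q P : {poly R}) :
  ind_left x Q P = half_ind x (sign_left x) Q P.
Proof.
rewrite /ind_left /half_ind /sign_left; case: ltnP => // ltQP.
rewrite sgzM mulrACA -exprD [in RHS]intrM rmorph_sign; congr (_ * _ / _).
by rewrite -signr_odd -[RHS]signr_odd oddD oddB ?(ltnW ltQP)// addbC.
Qed.

(** If neither polynomial vanishes at [x], both sides are 0. If exactly one does, the variation at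
    [x] is 1/2, and the formula becomes the identity st/2 = 1/2 - |s - t|/2 for signs s, t = 1 or
    -1. *)
Lemma half_ind_inversion {R : realFieldType} (x : R) (s : {poly R} -> int)
    (P Q : {poly R}) : P != 0 -> Q != 0 -> ~~ (root P x && root Q x) ->
  (forall T : {poly R}, T != 0 -> s T = 1 \/ s T = -1) ->
  (forall T : {poly R}, T.[x] != 0 -> s T = sgz T.[x]) ->
  half_ind x s Q P + half_ind x s P Q = var_at x P Q - sgn_var (s P) (s Q).
Proof.
move=> P0 Q0 PQ s1 sE; rewrite /half_ind /var_at /sgn_var.
have mup0 (T : {poly R}) : T != 0 -> (0 < mup x T)%N = root T x.
  by move=> T0; rewrite -XsubC_dvd// dvdp_XsubCl.
have [Px|Px] := boolP (root P x); have [Qx|Qx] := boolP (root Q x).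
- by rewrite Px Qx in PQ.
- rewrite (mupNroot Qx) mup0// Px ltn0 (eqP Px) sgz0 -sE//.
  by case: (s1 P P0) => ->; case: (s1 Q Q0) => ->.
- rewrite (mupNroot Px) mup0// Qx ltn0 (eqP Qx) sgz0 -sE//.
  by case: (s1 P P0) => ->; case: (s1 Q Q0) => ->.
- by rewrite (mupNroot Qx) (mupNroot Px) ltnn -!sE// addr0 subrr.
Qed.

Lemma ind_right_inversion {R : realFieldType} (x : R) (P Q : {poly R}) :
  P != 0 -> Q != 0 -> ~~ (root P x && root Q x) ->
  ind_right x Q P + ind_right x P Q
  = var_at x P Q - sgn_var (sign_right x P) (sign_right x Q).
Proof.
move=> P0 Q0 PQ; rewrite !ind_rightE half_ind_inversion//.
- exact: sign_right_neq0.
- exact: sign_right_nroot.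
Qed.

Lemma ind_left_inversion {R : realFieldType} (x : R) (P Q : {poly R}) :
  P != 0 -> Q != 0 -> ~~ (root P x && root Q x) ->
  ind_left x Q P + ind_left x P Q
  = var_at x P Q - sgn_var (sign_left x P) (sign_left x Q).
Proof.
move=> P0 Q0 PQ; rewrite !ind_leftE half_ind_inversion//.
- exact: sign_left_neq0.
- exact: sign_left_nroot.
Qed.

(** * From points to intervals *)

Lemma half_ind_nroot {R : realFieldType} (x : R) (s : {poly R} -> int)
    (Q P : {poly R}) : ~~ root P x -> half_ind x s Q P = 0.
Proof. by move=> Px; rewrite /half_ind (mupNroot Px) ltn0. Qed.

Lemma ind_at_nroot {R : realFieldType} (x : R) (Q P : {poly R}) :
  ~~ root P x -> ind_at x Q P = 0.
Proof.
by move=> Px; rewrite /ind_at ind_rightE ind_leftE !half_ind_nroot// subrr.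
Qed.

(** Entries of [r] that are not roots of [P] contribute 0; hence one list can serve both a pair and
    the swapped pair. *)
Lemma ind_abE {R : realFieldType} (a b : R) (Q P : {poly R}) (r : seq R) :
  P != 0 -> Q != 0 -> uniq r -> (forall x, x \in r -> a < x < b) ->
  (forall x, a < x < b -> root P x -> x \in r) ->
  ind_ab a b Q P
  = ind_right a Q P + \sum_(x <- r) ind_at x Q P - ind_left b Q P.
Proof.
move=> P0 Q0 ur rab rP; rewrite /ind_ab (negPf P0) (negPf Q0)/=.
congr (_ + _ - _); rewrite [in RHS]fsbig_seq//; apply/esym/fsbig_widen => [x|x []].
  exact: rab.
move=> /= xab xr; apply: ind_at_nroot; apply/negP => Px.
by apply: xr => /=; apply: rP.
Qed.

(** The matching hypothesis concerns neighbours in the list [a], [r], [b]; being neighbours is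
    expressed by having no entry of [r] strictly between. *)
Lemma telescope_path {R : realFieldType} (f g : R -> rat) (a b : R) (r : seq R) :
  path <%R a (rcons r b) ->
  (forall x y, x \in a :: r -> y \in rcons r b -> x < y ->
     (forall z, z \in r -> ~~ (x < z < y)) -> g x = f y) ->
  \sum_(x <- r) (f x - g x) = g a - f b.
Proof.
elim: r a => [|x r IHr] a /=.
  rewrite andbT => ab fg; rewrite big_nil (fg a b) ?subrr ?mem_head//.
case/andP=> ax xr fg.
have lt_x z : z \in rcons r b -> x < z.
  by move: xr; rewrite (path_sortedE lt_trans) => /andP[/allP + _] => /[apply].
rewrite big_cons (IHr x)//.
  rewrite (fg a x) ?mem_head//; first by rewrite addrA subrK.
  move=> z; rewrite inE => /orP[/eqP->|zr]; first by rewrite ltxx andbF.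
  by rewrite [z < x]le_gtF ?andbF// ltW// lt_x// mem_rcons inE zr orbT.
move=> u y ur yr uy nz; apply: fg => //.
- by rewrite inE ur orbT.
- by rewrite inE yr orbT.
(* The head [x] cannot lie strictly between [u] and [y], because [u] is [x] or a later entry. *)
move=> z; rewrite inE => /orP[/eqP->|/nz//].
apply/negP => /andP[ux _]; move: ur; rewrite inE => /orP[/eqP uE|ur].
  by rewrite uE ltxx in ux.
by have := lt_x u; rewrite mem_rcons inE ur orbT (lt_gtF ux) => /(_ isT).
Qed.

Lemma var_at0 {R : realFieldType} (x : R) (Q : {poly R}) :
  ~~ root Q x -> var_at x 0 Q = 2^-1.
Proof.
by move=> Qx; rewrite /var_at horner0 sgz0 sub0r normrN normr_sgz Qx mul1r.
Qed.

Lemma var_atC {R : realFieldType} (x : R) (P Q : {poly R}) :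
  var_at x P Q = var_at x Q P.
Proof. by rewrite /var_at distrC. Qed.

Lemma ind_inversion {R : realFieldType} {n : nat} (hR : IVT R n) (a b : R)
    (P Q : {poly R}) : a < b -> (size P <= n.+1)%N -> (size Q <= n.+1)%N ->
  (forall x, a <= x <= b -> ~~ (root P x && root Q x)) ->
  ind_ab a b Q P + ind_ab a b P Q = var_ab a b P Q.
Proof.
move=> ab szP szQ PQ.
have PQa : ~~ (root P a && root Q a) by rewrite PQ// lexx ltW.
have PQb : ~~ (root P b && root Q b) by rewrite PQ// lexx ltW.
have [P0|P0] := eqVneq P 0.
  (* Both indices are 0 by convention, and [Q] has no root at [a] or [b], so the two variations are
     both 1/2 and cancel. *)
  rewrite P0 !root0/= in PQa PQb *.
  by rewrite /ind_ab /var_ab !eqxx orbT !var_at0// subrr.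
have [Q0|Q0] := eqVneq Q 0.
  rewrite Q0 !root0 !andbT/= in PQa PQb *.
  by rewrite /ind_ab /var_ab !eqxx orbT !(var_atC _ P) !var_at0// subrr.
(* Taking the roots of the product keeps both [P] and [Q] free of roots between neighbouring
   points. *)
have [r [sr rab rPQ]] := finite_roots_itv a b (mulf_neq0 P0 Q0).
have ur : uniq r by exact: lt_sorted_uniq.
rewrite (ind_abE _ _ _ _ r)// => [|x xab Px]; last by rewrite rPQ// rootM Px.
rewrite (ind_abE _ _ _ _ r)// => [|x xab Qx]; last first.
  by rewrite rPQ// rootM Qx orbT.
pose f x := sgn_var (sign_left x P) (sign_left x Q).
pose g x := sgn_var (sign_right x P) (sign_right x Q).
have sumE : \sum_(x <- r) ind_at x Q P + \sum_(x <- r) ind_at x P Q = g a - f b.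
  rewrite -big_split/= -(telescope_path f g a b r).
  - apply: eq_big_seq => x xr; have /andP[/ltW ax /ltW xb] := rab x xr.
    have PQx : ~~ (root P x && root Q x) by rewrite PQ// ax.
    have := ind_right_inversion x P Q P0 Q0 PQx.
    have := ind_left_inversion x P Q P0 Q0 PQx.
    rewrite /ind_at -/(f x) -/(g x); lra.
  - rewrite (path_sortedE lt_trans) all_rcons ab/=; apply/andP; split.
      by apply/allP => x /rab/andP[].
    have : forall x, x \in r -> x < b by move=> x /rab/andP[].
    elim: {rab rPQ ur} r sr => //= x r IHr xr lt_b.
    rewrite rcons_path xr/=; apply: lt_b.
    by rewrite mem_last.
  - move=> x y xr yr xy nz.
    have noroot T : T != 0 -> T %| P * Q -> forall z, x < z < y -> ~~ root T z.
      move=> T0 /dvdpP[T' PQE] z zxy; apply/negP => Tz.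
      have : z \in r.
        apply: rPQ; last by rewrite PQE rootM Tz orbT.
        case/andP: zxy => xz zy; apply/andP; split.
          move: xr; rewrite inE => /orP[/eqP <-//|/rab/andP[ax _]].
          exact: lt_trans xz.
        move: yr; rewrite mem_rcons inE => /orP[/eqP <-//|/rab/andP[_]].
        exact: lt_trans.
      by move=> /nz; rewrite zxy.
    rewrite /g /f (sign_right_left hR szP P0 xy) ?(sign_right_left hR szQ Q0 xy)//.
      by apply: noroot => //; exact: dvdp_mulIr.
    by apply: noroot => //; exact: dvdp_mulIl.
(* Only the inner side of each endpoint enters, and its terms [g a] and [f b] cancel those left by
   the telescoping sum. *)
have := ind_right_inversion a P Q P0 Q0 PQa.
have := ind_left_inversion b P Q P0 Q0 PQb.
by rewrite /var_ab -/(f b) -/(g a); move: sumE; lra.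
Qed.

(** * Comparison of indices with the same denominator *)

(** At a root of [P] both numerators have multiplicity 0, so their one-sided signs are the signs of
    their values and the factor [c] comes out of every local index. *)
Lemma ind_abZ {R : realFieldType} (a b : R) (P Q Q' : {poly R}) (c : int) :
  a < b -> P != 0 -> Q != 0 -> Q' != 0 ->
  (forall x, a <= x <= b -> root P x -> ~~ root Q x) ->
  (forall x, a <= x <= b -> root P x -> ~~ root Q' x) ->
  (forall x, a <= x <= b -> root P x -> sgz Q'.[x] = c * sgz Q.[x]) ->
  ind_ab a b Q' P = c%:~R * ind_ab a b Q P.
Proof.
move=> ab P0 Q0 Q'0 Qx Q'x cQ.
have [r [sr rab rP]] := finite_roots_itv a b P0.
have ur : uniq r by exact: lt_sorted_uniq.
have half x (s : {poly R} -> int) : a <= x <= b ->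
    (forall T : {poly R}, T.[x] != 0 -> s T = sgz T.[x]) ->
    half_ind x s Q' P = c%:~R * half_ind x s Q P.
  move=> xab sE; have [Px|Px] := boolP (root P x); last first.
    by rewrite !half_ind_nroot// mulr0.
  have [Qn Q'n] := (Qx x xab Px, Q'x x xab Px).
  rewrite /half_ind (mupNroot Qn) (mupNroot Q'n).
  case: ifP => _; last by rewrite mulr0.
  by rewrite (sE Q)// (sE Q')// cQ// -mulrA intrM mulrA.
have halfr x (xab : a <= x <= b) := half x _ xab (sign_right_nroot x).
have halfl x (xab : a <= x <= b) := half x _ xab (sign_left_nroot x).
rewrite !(ind_abE a b _ P r)// !ind_rightE !ind_leftE.
rewrite halfr ?lexx ?ltW// halfl ?lexx ?ltW// mulrBr mulrDr; congr (_ + _ - _).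
rewrite mulr_sumr; apply: eq_big_seq => x /rab/andP[/ltW ax /ltW xb].
by rewrite /ind_at !ind_rightE !ind_leftE halfr ?halfl ?ax ?xb// mulrBr.
Qed.

Lemma ind_ab_nroot {R : realFieldType} (a b : R) (P Q : {poly R}) : a < b ->
  (forall x, a <= x <= b -> ~~ root P x) -> ind_ab a b Q P = 0.
Proof.
move=> ab Px; have P0 : P != 0.
  by apply: contraNneq (Px a _) => [->|]; rewrite ?root0// lexx ltW.
have [->|Q0] := eqVneq Q 0; first by rewrite /ind_ab eqxx orbT.
rewrite (ind_abE a b Q P [::])// => [|x /andP[/ltW ax /ltW xb]].
  rewrite big_nil ind_rightE ind_leftE !half_ind_nroot ?subr0 ?addr0//.
    by rewrite Px// ltW/=.
  by rewrite Px// lexx ltW.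
by rewrite (negPf (Px _ _))// ax.
Qed.

(* Q and Q' stand for S_(i-1) and S_(i+1), P for S_i. *)
Lemma ind_ab_flip {R : realFieldType} (a b : R) (A B C P Q Q' : {poly R})
    (s t : int) : a < b -> s * s = 1 ->
  A * Q' + B * P + C * Q = 0 ->
  (forall x, a <= x <= b -> sgz A.[x] = s /\ sgz C.[x] = t) ->
  (forall x, a <= x <= b -> ~~ (root P x && root Q' x)) ->
  (forall x, a <= x <= b -> ~~ (root Q x && root P x)) ->
  ind_ab a b Q' P = - (s * t)%:~R * ind_ab a b Q P.
Proof.
move=> ab s1 rel AC PQ' QP.
have [->|P0] := eqVneq P 0; first by rewrite /ind_ab eqxx mulr0.
(* A zero numerator shares every root of [P], so [P] has no root on the interval and both indices
   vanish. *)
have [Q0|Q0] := eqVneq Q 0.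
  have Px x : a <= x <= b -> ~~ root P x.
    by move=> xab; have := QP x xab; rewrite Q0 root0.
  by rewrite !ind_ab_nroot// mulr0.
have [Q'0|Q'0] := eqVneq Q' 0.
  have Px x : a <= x <= b -> ~~ root P x.
    by move=> xab; have := PQ' x xab; rewrite Q'0 root0 andbT.
  by rewrite !ind_ab_nroot// mulr0.
rewrite -rmorphN/=; apply: ind_abZ => // x xab Px.
- by have := QP x xab; rewrite Px andbT.
- by have := PQ' x xab; rewrite Px.
have [Ax Cx] := AC x xab.
have : A.[x] * Q'.[x] = - (C.[x] * Q.[x]).
  apply/eqP; rewrite -subr_eq0 opprK; apply/eqP.
  have := congr1 (fun p : {poly R} => p.[x]) rel.
  by rewrite !hornerE (eqP Px) mulr0 addr0.
(* Since [s] is its own inverse, multiplying by it isolates the sign of [Q']. *)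
move=> /(congr1 (@sgz R)); rewrite sgzN !sgzM Ax Cx => /(congr1 ( *%R s)).
by rewrite mulrA s1 mul1r => ->; rewrite mulrN mulrA mulNr.
Qed.

(** * Summation along the chain *)

Lemma telescope_cancel {f g : nat -> rat} {n : nat} : (0 < n)%N ->
  (forall i, (1 <= i < n)%N -> g i + f i.+1 = 0) ->
  f 1%N + g n = \sum_(1 <= i < n.+1) (f i + g i).
Proof.
case: n => // n _; elim: n => [|n IHn] fg; first by rewrite big_nat1.
rewrite big_nat_recr//= -IHn => [|i /andP[i1 ltin]].
  by have := fg n.+1; rewrite ltnSn => /(_ isT); lra.
by apply: fg; rewrite i1 ltnS ltnW.
Qed.

(** At a common root of two consecutive terms the relation leaves only its [A] term, and [A] is
    nonzero there, so the next term vanishes too. The common root thus moves up to the last pair,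
    where it is excluded; [k] counts the steps to that pair. *)
Lemma sturm_chain_coprime {R : realFieldType} {n : nat}
    {sigma tau : n.-1.-tuple int} {a b : R} {Ss : n.+1.-tuple {poly R}} :
  {subset sigma <= [:: -1; 1]} -> sturm_chain sigma tau `[a, b] Ss ->
  forall i, (i < n)%N -> forall x, a <= x <= b ->
  ~~ (root Ss`_i x && root Ss`_i.+1 x).
Proof.
move=> hsigma [hC hS] i ltin x xab.
have xI : x \in `[a, b] by rewrite in_itv.
have [k kE] : exists k, (i + k)%N = n.-1.
  by exists (n.-1 - i)%N; rewrite subnKC// -ltnS (ltn_predK ltin).
elim: k i ltin kE => [|k IHk] i ltin kE; apply/negP => /andP[Six SSix].
  rewrite addn0 in kE; rewrite {}kE (ltn_predK ltin) in Six SSix.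
  by apply: hS; exists x.
have lt_i : (i.+1 <= n.-1)%N by rewrite -kE addnS ltnS leq_addr.
have ltSin : (i.+1 < n)%N by rewrite -(ltn_predK ltin) ltnS.
have /negP := IHk i.+1 ltSin (etrans (addSnnS i k) kE); apply; rewrite SSix/=.
have [A [B [C [rel AC]]]] := hC i.+1 lt_i.
have [Ax _] := AC x xI.
have Ax0 : A.[x] != 0.
  rewrite -sgz_eq0 Ax /=.
  have : sigma`_i \in [:: -1; 1] by rewrite hsigma// mem_nth// size_tuple.
  by rewrite !inE => /orP[] /eqP ->.
have := congr1 (fun p : {poly R} => p.[x]) rel.
rewrite !hornerE/= (eqP SSix) (eqP Six) !mulr0 !addr0 => /eqP.
by rewrite mulf_eq0 (negPf Ax0).
Qed.

Theorem proposition34 (d : nat) (hd : (2 <= d)%N) (R : realFieldType)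
    (hR : IVT R (d ^ 2)%N) (a b : R) (hab : a < b)
    (n : nat) (hn : (1 <= n)%N) (sigma tau : n.-1.-tuple int)
    (hsigma : {subset sigma <= [:: -1; 1]}) (htau : {subset tau <= [:: -1; 1]})
    (Ss : n.+1.-tuple {poly R})
    (hS : sturm_chain sigma tau `[a, b] Ss)
    (hdeg : forall i : nat, (i <= n)%N -> (size (Ss`_i)%R <= (d ^ 2).+1)%N) :
  ind_ab a b Ss`_1 Ss`_0 + (eps sigma tau n)%:~R * ind_ab a b Ss`_n.-1 Ss`_n
  = var_chain sigma tau a b Ss.
Proof.
have nroot := sturm_chain_coprime hsigma hS.
have [hC _] := hS.
(* [f i + g i] is the weighted inversion formula of the i-th pair; [g i] and [f i.+1] share the
   denominator S_i and cancel. *)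
pose f i := (eps sigma tau i)%:~R * ind_ab a b Ss`_i Ss`_i.-1.
pose g i := (eps sigma tau i)%:~R * ind_ab a b Ss`_i.-1 Ss`_i.
have -> : ind_ab a b Ss`_1 Ss`_0 = f 1%N by rewrite /f /eps big_geq// mul1r.
rewrite -/(g n) (telescope_cancel hn) => [|[//|i] /andP[_ ltin]].
  rewrite /var_chain; apply: eq_big_nat => -[//|i] /andP[_ ltin].
  rewrite /f /g /= -mulrDr (ind_inversion hR)//; first exact/hdeg/ltnW.
  - exact: hdeg.
  - exact: nroot.
have lt_i : (i.+1 <= n.-1)%N by rewrite -ltnS (ltn_predK ltin).
have [A [B [C [rel AC]]]] := hC i.+1 lt_i.
have sqr1 (u : n.-1.-tuple int) : {subset u <= [:: -1; 1]} -> u`_i * u`_i = 1.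
  move=> hu; have : u`_i \in [:: -1; 1] by rewrite hu// mem_nth// size_tuple.
  by rewrite !inE => /orP[] /eqP ->.
have := ind_ab_flip a b A B C _ _ _ _ _ hab (sqr1 _ hsigma) rel AC
  (nroot i.+1 ltin) (nroot i (ltnW ltin)).
rewrite /= => flip; rewrite /f /g /= flip.
(* The last factor of the longer product is the factor produced by the flip; the two multiply to 1,
   leaving opposite terms. *)
rewrite /eps [X in _ + X%:~R * _]big_nat_recr//= -/(eps _ _ _).
rewrite [(_ * (_ * _))%:~R]intrM mulNr mulrN -mulrA.
rewrite [X in _ - _ * X]mulrA -intrM mulrACA (sqr1 _ hsigma) (sqr1 _ htau).
by rewrite !mul1r subrr.
Qed.
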